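(* For every positive integer $n$, the conjugation map defined below is an involution on the set of partitions of $[n]=\{1,\ldots,n\}$. Moreover, for every partition $\pi$ of $[n]$, the number of singletons of the conjugate of $\pi$ equals the number of adjacencies of $\pi$, and the number of adjacencies of the conjugate of $\pi$ equals the number of singletons of $\pi$.
   Context: Partitions on finite sets of positive integers: a partition $\pi$ of a finite set $A\subset\mathbb{Z}_{>0}$ (its support, $\mathrm{supp}(\pi)=A$) is a set of nonempty pairwise disjoint blocks with union $A$; the empty partition $\epsilon$ has empty support. List $A=\{a_1<a_2<\cdots<a_m\}$; the successor of $a_i$ is $a_{i+1}$ for $i<m$ and the successor of $a_m$ is $a_1$ (cyclic). An element $a$ is an adjacency initiator of $\pi$ if $a$ and its successor $b\neq a$ lie in the same block, in which case $b$ is an adjacency terminator and $(a,b)$ is an adjacency; if $|A|=1$, its unique element is considered to be both an adjacency initiator and an adjacency terminator (and it is also a singleton). An element is a singleton if it forms a block by itself. For the partitions of $[n]$ this gives: singletons are one-element blocks and adjacencies are pairs $(i,i+1)$ or $(n,1)$ within one block. Define $\mathrm{SeparateIS}(\pi)=(\rho,(I,S))$, where $I$ is the set of adjacency initiators of $\pi$, $S$ the set of singleton elements of $\pi$, and $\rho$ is the partition of $\mathrm{supp}(\pi)\setminus(I\cup S)$ obtained from $\pi$ by deleting the elements of $I\cup S$ from their blocks (and discarding blocks that become empty). Define $\mathrm{SeparateST}(\pi)=(\rho,(T,S))$ analogously, with $T$ the set of adjacency terminators of $\pi$ and $\rho$ obtained by deleting $T\cup S$. Both maps are injective and have the same image;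 let $\mathrm{CombineST}$ denote the inverse of $\mathrm{SeparateST}$ on this image. The map $\phi$ on partitions of $[n]$: given $\pi$, set $\rho_0=\pi$ and $(\rho_j,(I_j,S_j))=\mathrm{SeparateIS}(\rho_{j-1})$ for $j=1,2,\ldots$, stopping at the first $k\ge1$ for which $\rho_k$ has no adjacency initiators and no singletons. Then set $\tau_k=\rho_k$ and $\tau_{j-1}=\mathrm{CombineST}(\tau_j,(I_j,S_j))$ for $j=k,k-1,\ldots,1$, and define $\phi(\pi)=\tau_0$. The complement of a partition $\pi$ of $[n]$ is the partition obtained by replacing each element $x$ by $n+1-x$. The conjugate of $\pi$ is the complement of $\phi(\pi)$.
   Formalization: SeparateST is taken to output (ρ,(S,T)) instead of (ρ,(T,S)), so CombineST turns I_j into singletons and S_j into adjacency terminators; with the order (T,S) the claim fails for n=2, π={{1,2}}. *)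

(* Defs.v *)
From mathcomp Require Import all_boot.

Set Implicit Arguments.
Unset Strict Implicit.
Unset Printing Implicit Defensive.

(* The ground set {1, ..., n} is 'I_n, with i : 'I_n standing for the integer *)
(* i + 1. A partition of A is pi with [partition pi A]; its support is        *)
(* [cover pi].                                                                *)

Section Conjugation.

Variable n : nat.

Implicit Types (pi rho tau : {set {set 'I_n}}) (A D : {set 'I_n}).

(* [enum A] lists A in increasing order, and [next] wraps around from the     *)
(* last item to the first one.                                                *)
Definition successor A (a : 'I_n) : 'I_n := next (enum A) a.

(* On a one-element support {a} the pair (a, a) counts as an adjacency, so    *)
(* that a is both an adjacency initiator and an adjacency terminator.         *)
Definition adjacencies pi : {set 'I_n * 'I_n} :=
  [set p | [&& p.1 \in cover pi,
               p.2 == successor (cover pi) p.1,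
               p.2 \in pblock pi p.1
             & (p.2 != p.1) || (#|cover pi| == 1)]].

Definition initiators pi : {set 'I_n} := [set p.1 | p in adjacencies pi].

Definition terminators pi : {set 'I_n} := [set p.2 | p in adjacencies pi].

Definition singletons pi : {set 'I_n} := [set a | [set a] \in pi].

Definition delete D pi : {set {set 'I_n}} := [set B :\: D | B in pi] :\ set0.

Definition separateIS pi : {set {set 'I_n}} * ({set 'I_n} * {set 'I_n}) :=
  (delete (initiators pi :|: singletons pi) pi,
   (initiators pi, singletons pi)).

(* The singletons come first here, whereas they come second in [separateIS]:  *)
(* reading the output (rho, (I, S)) of [separateIS] as an output of           *)
(* [separateST] turns I into a set of singletons and S into a set of          *)
(* adjacency terminators.                                                     *)
Definition separateST pi : {set {set 'I_n}} * ({set 'I_n} * {set 'I_n}) :=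
  (delete (terminators pi :|: singletons pi) pi,
   (singletons pi, terminators pi)).

(* The inverse of [separateST] on its image, where partitions may have any    *)
(* support in 'I_n; set0 is a dummy value outside the image.                  *)
Definition combineST (x : {set {set 'I_n}} * ({set 'I_n} * {set 'I_n})) :
    {set {set 'I_n}} :=
  odflt set0 [pick pi | partition pi (cover pi) && (separateST pi == x)].

Definition residue pi (j : nat) : {set {set 'I_n}} :=
  iter j (fun rho => (separateIS rho).1) pi.

Definition stops pi (k : nat) : bool :=
  [&& 0 < k, initiators (residue pi k) == set0
    & singletons (residue pi k) == set0].

Lemma cover_delete D pi : cover (delete D pi) = cover pi :\: D.
Proof.
apply/setP=> x; rewrite inE; apply/bigcupP/andP.
  case=> C; rewrite !inE => /andP[_ /imsetP[B Bpi ->]].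
  by rewrite inE => /andP[-> xB]; split=> //; apply/bigcupP; exists B.
case=> xD /bigcupP[B Bpi xB]; exists (B :\: D); last by rewrite inE xD.
rewrite !inE (imset_f (fun B => B :\: D)) // andbT.
by apply/set0Pn; exists x; rewrite inE xD.
Qed.

Lemma initiators_sub pi : initiators pi \subset cover pi.
Proof. by apply/subsetP=> x /imsetP[p]; rewrite inE => /and4P[+ _ _ _] ->. Qed.

Lemma singletons_sub pi : singletons pi \subset cover pi.
Proof.
apply/subsetP=> x; rewrite inE => xpi.
by apply/bigcupP; exists [set x]; rewrite ?set11.
Qed.

Lemma stops_residue1 pi k : stops (separateIS pi).1 k -> stops pi k.+1.
Proof. by rewrite /stops /residue iterSr => /andP[_ ->]. Qed.

Lemma ex_stops pi : exists k, stops pi k.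
Proof.
have no0 rho : set0 \notin (separateIS rho).1 by rewrite setD11.
suff H m rho : set0 \notin rho -> #|cover rho| < m -> exists k, stops rho k.
  have [k stk] := H _ _ (no0 pi) (ltnSn _).
  by exists k.+1; apply: stops_residue1.
elim: m rho => // m IHm rho rho0; rewrite ltnS => rho_m.
pose D := initiators rho :|: singletons rho.
have sD : D \subset cover rho by rewrite subUset initiators_sub singletons_sub.
have [D0 | /set0Pn[x xD]] := eqVneq D set0.
  have rho1 : (separateIS rho).1 = rho.
    rewrite /= -/D D0; apply/setP=> B; rewrite !inE.
    have -> : [set C :\: set0 | C in rho] = rho.
      rewrite -[RHS]imset_id; apply: eq_imset => C; exact: setD0.
    by case: eqVneq => // ->; rewrite (negPf rho0).
  exists 1; rewrite /stops /residue /= -/(separateIS rho).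
  have /= -> := rho1.
  by move/eqP: D0; rewrite setU_eq0 => /andP[-> ->].
have lt1 : #|cover (separateIS rho).1| < m.
  apply: leq_trans rho_m; rewrite cover_delete; apply: proper_card.
  rewrite properE subsetDl; apply/subsetPn.
  by exists x; [apply: (subsetP sD) | rewrite inE xD].
have [k stk] := IHm _ (no0 rho) lt1.
by exists k.+1; apply: stops_residue1.
Qed.

(* The first k >= 1 at which the separation stops. *)
Definition depth pi : nat := ex_minn (ex_stops pi).

(* Unfolds to tau_0, where tau_k = rho_k and                                  *)
(* tau_(j-1) = combineST (tau_j, (I_j, S_j)) for j = k, ..., 1.               *)
Definition phi pi : {set {set 'I_n}} :=
  foldr (fun j tau => combineST (tau, (separateIS (residue pi j.-1)).2))
        (residue pi (depth pi)) (iota 1 (depth pi)).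

(* [rev_ord] sends i to n - 1 - i, that is, the integer x = i + 1 to n + 1 - x. *)
Definition complement pi : {set {set 'I_n}} :=
  [set [set rev_ord a | a in B] | B : {set 'I_n} in pi].

Definition conjugate pi : {set {set 'I_n}} := complement (phi pi).

End Conjugation.

(* Main.v *)
Require Import Defs.
From mathcomp Require Import all_boot.

(* Reversing the cyclic order exchanges adjacency initiators and terminators, *)
(* so [complement] carries [separateST] to [separateIS] and conversely. If     *)
(* (rho', (I, S)) = separateIS rho and tau' is a partition of the support of   *)
(* rho' whose singletons are the initiators of rho' and whose terminators are  *)
(* the singletons of rho', then (tau', (I, S)) lies in the image of            *)
(* [separateST]: between cyclically consecutive elements of the support of     *)
(* rho' lies a run of elements of S followed by a run of elements of I, and    *)
(* both membership conditions ask for a nonempty run after each initiator of   *)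
(* rho' (in S) and before each singleton of rho' (in I). By induction phi pi   *)
(* has the initiators of pi as singletons and the singletons of pi as          *)
(* terminators, and separating its complement retraces the complements of the  *)
(* tau_j; as [separateST] is injective, recombining yields the complement of   *)
(* pi.                                                                         *)

(** One round of recombination is made explicit: from [rho] and a partition [tau] mirrored to its
    residue, [recombined] isolates every initiator of [rho] and attaches every singleton of [rho] to
    its predecessor. Its singletons and terminators are then the initiators and singletons of [rho],
    and deleting them leaves [tau] ([singletons_recombined], [starts_recombined],
    [delete_recombined]). Since separation is injective ([separate_inj]), [combineST] must return
    this partition ([combineST_mirrored]). Iterating gives [mirrored_phi], from which the two counts
    follow, as complementation swaps initiators with terminators. The same steps read through the
    complement give [rebuild_complement_rebuild], hence the involution. *)

Set Implicit Arguments.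
Unset Strict Implicit.
Unset Printing Implicit Defensive.

(** * Cyclic successors in a duplicate-free list *)

Section Next.

Variable T : finType.
Implicit Types (e : seq T) (D : {set T}).

Lemma head_filter_traject (f : T -> T) (a : pred T) (x0 x : T) k m :
  k < m -> a (iter k f x) -> (forall j, j < k -> ~~ a (iter j f x)) ->
  head x0 (filter a (traject f x m)) = iter k f x.
Proof.
elim: k m x => [|k IHk] [|m] x //= ltkm ak anj; first by rewrite ak.
rewrite (negPf (anj 0 isT)) -iterS iterSr; apply: IHk => //.
  by rewrite -iterSr.
by move=> j ltjk; rewrite -iterSr anj.
Qed.

(** Successors in a smaller support are found by walking along the larger one and skipping the
    deleted elements. *)
Lemma next_filter e (a : pred T) x k :
    uniq e -> x \in e -> a x -> a (iter k.+1 (next e) x) ->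
    (forall j, j < k -> ~~ a (iter j.+1 (next e) x)) ->
  next (filter a e) x = iter k.+1 (next e) x.
Proof.
move=> Ue xe ax ak anj; have [i s def_s] := rot_to xe.
(* Filtering a rotation of [e] rotates the filtered list, which leaves [next] unchanged; so the list
   may start at [x]. *)
have -> : next (filter a e) x = next (filter a (rot i e)) x.
  rewrite /rot -[e in LHS](cat_take_drop i e) !filter_cat.
  rewrite -(rot_size_cat (filter a (take i e))).
  by rewrite next_rot // -filter_cat cat_take_drop filter_uniq.
set f := next e in ak anj *.
have fcyc : fcycle f (rot i e) by rewrite rot_cycle; apply: cycle_next.
rewrite def_s /= ax; have -> : next (x :: filter a s) x = head x (filter a s).
  by case: (filter a s) => [|y s'] /=; rewrite eqxx.
have := fcyc; rewrite def_s /= => /fpathP[m def_m].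
have m_gt0 : m = (size s).+1 by rewrite -(size_rcons s x) def_m size_traject.
have lastx : iter (size s).+1 f x = x.
  by have := last_rcons x s x; rewrite def_m m_gt0 last_traject.
(* The trajectory is [s] followed by [x]; the extra [x] changes nothing, being also the default of
   [head]. *)
have -> : head x (filter a s) = head x (filter a (traject f (f x) m)).
  by rewrite -def_m -cats1 filter_cat /= ax; case: (filter a s).
rewrite -iterS iterSr; apply: head_filter_traject; rewrite ?m_gt0 -?iterSr //.
  (* Otherwise the walk would be back at [x], where [a] holds, while still skipping. *)
  rewrite ltnNge; apply/negP => /anj; by rewrite lastx ax.
by move=> j /anj; rewrite -iterSr.
Qed.

Lemma next_reach e x y :
  uniq e -> x \in e -> y \in e -> exists2 k, k < #|T| & iter k (next e) x = y.
Proof.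
move=> Ue xe ye; have xy : fconnect (next e) x y.
  by rewrite (fconnect_cycle (cycle_next Ue)).
exists (findex (next e) x y); last exact: iter_findex.
by apply: leq_trans (findex_max xy) _; apply: max_card.
Qed.

(* The first element outside D at or after x: if e leaves D at all, then it    *)
(* does so within #|T| steps.                                                 *)
Definition land e D (x : T) : T :=
  iter #|T| (fun y => if y \in D then next e y else y) x.

Lemma landP e D x :
    uniq e -> x \in e -> (exists2 y, y \in e & y \notin D) ->
  exists k, [/\ land e D x = iter k (next e) x, land e D x \notin D
             & forall j, j < k -> iter j (next e) x \in D].
Proof.
move=> Ue xe [y ye yD]; have [m ltm def_y] := next_reach Ue xe ye.
have ex_k : exists k, iter k (next e) x \notin D by exists m; rewrite def_y.
case: (ex_minnP ex_k) => k kD min_k; have jD j : j < k -> iter j (next e) x \in D.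
  by rewrite ltnNge; apply: contraR => /min_k.
have lekT : k <= #|T|.
  by apply: leq_trans (ltnW ltm); apply: min_k; rewrite def_y.
have land_k : land e D x = iter k (next e) x.
  rewrite /land -(subnK lekT) iterD.
  have -> : iter k (fun y => if y \in D then next e y else y) x
            = iter k (next e) x.
    elim: {-2}k (leqnn k) => //= j IHj ltjk.
    by rewrite IHj ?(ltnW ltjk) // jD.
  by elim: (_ - _) => //= j ->; rewrite (negPf kD).
by exists k; split; rewrite ?land_k.
Qed.

Lemma land_step e D x :
  uniq e -> x \in e -> (exists2 y, y \in e & y \notin D) -> x \in D ->
  land e D (next e x) = land e D x.
Proof.
move=> Ue xe eD xD; have [k [_ landD _]] := landP Ue xe eD.
(* Starting one element earlier costs one more step, and that last step is idle because [land] has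
   already left [D]. *)
transitivity (iter #|T|.+1 (fun y => if y \in D then next e y else y) x).
  by rewrite iterSr xD.
by rewrite iterS -/(land e D x) (negPf landD).
Qed.

Lemma land_id e D x : x \notin D -> land e D x = x.
Proof. by rewrite /land => xD; elim: #|T| => //= k ->; rewrite (negPf xD). Qed.

Lemma land_ind e D x (Q : T -> Prop) :
  Q x -> (forall y, y \in D -> Q y -> Q (next e y)) -> Q (land e D x).
Proof.
by move=> Qx QD; rewrite /land; elim: #|T| => //= k; case: ifP => // /QD.
Qed.

End Next.

(** * Partitions through their block relation *)

Section Relation.

Variable T : finType.
Implicit Types (P Q : {set {set T}}) (A : {set T}).

Lemma eq_partition P Q A :
    partition P A -> partition Q A ->
    {in A &, forall x y, (y \in pblock P x) = (y \in pblock Q x)} ->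
  P = Q.
Proof.
move=> Ppart Qpart eqPQ.
rewrite -(preim_partition_pblock Ppart) -(preim_partition_pblock Qpart).
apply: eq_in_imset => x xA; apply/setP=> y; rewrite !inE.
case yA: (y \in A) => //=; case/and3P: Ppart => /eqP cP tP _.
by case/and3P: Qpart => /eqP cQ tQ _; rewrite !eq_pblock ?cP ?cQ ?eqPQ.
Qed.

Lemma pblock_preim (rT : eqType) (f : T -> rT) A x y :
  x \in A -> y \in A -> (y \in pblock (preim_partition f A) x) = (f x == f y).
Proof.
apply: (@pblock_equivalence_partition _ (fun x y => f x == f y)).
by move=> u v w _ _ _; split=> // /eqP->.
Qed.

End Relation.

Lemma next_fixed (T : finType) (e : seq T) x y :
  uniq e -> x \in e -> y \in e -> next e x = x -> y = x.
Proof.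
move=> Ue xe ye fix_x; have [k _ <-] := next_reach Ue xe ye.
by elim: k => //= k ->.
Qed.

Lemma pblock_notin (T : finType) (P : {set {set T}}) x :
  x \notin cover P -> pblock P x = set0.
Proof.
move=> xP; rewrite /pblock; case: pickP => //= B /andP[BP xB].
by case/bigcupP: xP; exists B.
Qed.

Lemma pblock_sub_cover (T : finType) (P : {set {set T}}) x :
  pblock P x \subset cover P.
Proof.
have [xP | /pblock_notin->] := boolP (x \in cover P); last exact: sub0set.
by apply: (bigcup_sup (pblock P x)); first exact: pblock_mem.
Qed.

Section Separation.

Variable n : nat.
Implicit Types (P Q rho tau : {set {set 'I_n}}) (A D : {set 'I_n}).
Implicit Types (e : seq 'I_n) (a b t x y : 'I_n).

Lemma singletonsP P x :
  partition P (cover P) ->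
  reflect (x \in cover P /\ forall y, y \in pblock P x -> y = x)
          (x \in singletons P).
Proof.
case/and3P=> _ tP _; rewrite inE; apply: (iffP idP) => [xP | [xP x1]].
  split; first by apply/bigcupP; exists [set x]; rewrite ?set11.
  by move=> y; rewrite (def_pblock tP xP) ?set11 // => /set1P.
suff <- : pblock P x = [set x] by apply: pblock_mem.
by apply/eqP; rewrite eqEsubset sub1set mem_pblock xP andbT;
  apply/subsetP=> y /x1->; rewrite set11.
Qed.

Lemma partition_delete D P :
  partition P (cover P) -> partition (delete D P) (cover (delete D P)).
Proof.
case/and3P=> _ /trivIsetP tP _; apply/and3P; split; rewrite ?setD11 //.
apply/trivIsetP => _ _ /setD1P[_ /imsetP[X XP ->]] /setD1P[_ /imsetP[Y YP ->]].
have [-> | neqXY _] := eqVneq X Y; first by rewrite eqxx.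
apply: disjointWl (subsetDl X D) _; apply: disjointWr (subsetDl Y D) _.
exact: tP.
Qed.

Lemma pblock_delete D P x :
    partition P (cover P) -> x \in cover (delete D P) ->
  pblock (delete D P) x = pblock P x :\: D.
Proof.
move=> Ppart xPD; have /and3P[_ tPD _] := partition_delete D Ppart.
have := xPD; rewrite cover_delete => /setDP[xP xD].
have xB : x \in pblock P x :\: D by rewrite inE xD mem_pblock.
apply: def_pblock => //; rewrite !inE; apply/andP; split.
  by apply/set0Pn; exists x.
by apply: imset_f; apply: pblock_mem.
Qed.

(* The condition of [adjacencies] on one-element supports is automatic here:   *)
(* if [next e a = a] then the support is {a}. The terminators are the starts   *)
(* for the reversed list.                                                     *)
Definition starts e P : {set 'I_n} :=
  [set a in cover P | next e a \in pblock P a].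

(** * Recovering a partition from its separation *)

Section Order.

Variables (e : seq 'I_n) (P : {set {set 'I_n}}).
Hypotheses (Ue : uniq e) (eP : e =i cover P) (Ppart : partition P (cover P)).

Local Notation I := (starts e P).
Local Notation S := (singletons P).
Local Notation rho := (delete (I :|: S) P).

Let tP : trivIset P. Proof. by case/and3P: Ppart. Qed.

Lemma mem_rest x : x \in cover P -> x \notin I -> x \notin S -> x \in cover rho.
Proof. by move=> xP xI xS; rewrite cover_delete in_setD in_setU negb_or xI xS. Qed.

Lemma mem_restP x :
  reflect [/\ x \in cover P, x \notin I & x \notin S] (x \in cover rho).
Proof.
rewrite cover_delete in_setD in_setU negb_or -andbA.
by apply: (iffP and3P) => -[].
Qed.

Lemma land_pblock a : a \in cover P -> land e I a \in pblock P a.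
Proof.
move=> aP; apply: (land_ind (Q := fun z => z \in pblock P a)) => [|y].
  by rewrite mem_pblock.
by rewrite inE => /andP[_ yy] /(same_pblock tP) <-.
Qed.

Lemma singleton_same a b : a \in S -> b \in cover P -> a \in pblock P b -> b = a.
Proof.
case/(singletonsP _ Ppart) => _ a1 bP /(same_pblock tP) eq_ab.
by apply: a1; rewrite eq_ab mem_pblock.
Qed.

Lemma land_rest a b :
  a \in cover P -> a \notin S -> b \in cover rho -> land e I a \in cover rho.
Proof.
move=> aP aS /mem_restP[bP bI _].
have [||k [_ landI _]] := @landP _ e I a Ue; first by rewrite eP.
  by exists b; rewrite ?eP.
have landa := land_pblock aP; apply: mem_rest => //.
  by rewrite -mem_pblock (same_pblock tP landa).
by apply: contra aS => landS; rewrite (singleton_same landS aP landa).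
Qed.

(** An initiator shares the block of its successor, so a non-singleton lies in the block of the
    first non-initiator reached from it. The block relation is thus a function of [I], [S] and
    [rho], which is what makes separation injective. *)
Lemma pblock_separate x y :
    x \in cover P -> y \in cover P ->
  (y \in pblock P x) =
    if (x \in S) || (y \in S) then y == x
    else pblock rho (land e I x) == pblock rho (land e I y).
Proof.
move=> xP yP; have [/orP xyS | /norP[xS yS]] := ifPn.
  apply/idP/eqP=> [yx | ->]; last by rewrite mem_pblock.
  case: xyS => [/(singletonsP _ Ppart)[_ x1] | yS]; first exact: x1.
  by rewrite (singleton_same yS xP yx).
(* If nothing is left, both blocks of [rho] are the default [set0] and the right side is true. The
   left side is true as well: walking from [x], one meets only initiators and never leaves its
   block. *)
have [rho0 | [b brho]] := set_0Vmem (cover rho).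
  rewrite !(pblock_notin (P := rho)) ?rho0 ?in_set0 // eqxx.
  have [||k _ <-] := @next_reach _ e x y Ue; rewrite ?eP //.
  elim: k => [|k IHk] /=; first by rewrite mem_pblock.
  have kP : iter k (next e) x \in cover P.
    by rewrite -mem_pblock (same_pblock tP IHk).
  have kS : iter k (next e) x \notin S.
    by apply: contra xS => kS; rewrite (singleton_same kS xP IHk).
  have: iter k (next e) x \in I.
    by apply: contraT => kI; have := mem_rest kP kI kS; rewrite rho0 inE.
  by rewrite inE => /andP[_]; rewrite (same_pblock tP IHk).
have Bx := land_rest xP xS brho; have By := land_rest yP yS brho.
have Lx := land_pblock xP; have Ly := land_pblock yP.
rewrite !pblock_delete // (same_pblock tP Lx) (same_pblock tP Ly).
rewrite -(eq_pblock _ tP xP); apply/eqP/eqP=> [-> // | eqxy].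
apply: same_pblock => //; have := mem_pblock rho (land e I x).
rewrite Bx pblock_delete // (same_pblock tP Lx) eqxy => /setDP[Lxy _].
by rewrite -(same_pblock tP Lxy) (same_pblock tP Lx) mem_pblock.
Qed.

End Order.
Lemma separate_inj e P Q :
    uniq e -> e =i cover P -> cover Q = cover P ->
    partition P (cover P) -> partition Q (cover Q) ->
    starts e P = starts e Q -> singletons P = singletons Q ->
    delete (starts e P :|: singletons P) P
      = delete (starts e Q :|: singletons Q) Q ->
  P = Q.
Proof.
move=> Ue eP cQ Ppart Qpart eqI eqS eq_rest.
have eQ : e =i cover Q by move=> z; rewrite cQ.
apply: (eq_partition Ppart) => [|x y xP yP]; first by move: Qpart; rewrite cQ.
rewrite (pblock_separate Ue) //.
by rewrite (pblock_separate Ue eQ Qpart) ?cQ // -eq_rest -eqI -eqS.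
Qed.

(** * Recombination with the roles of I and S exchanged *)

Section Recombine.

Variables (e : seq 'I_n) (rho tau : {set {set 'I_n}}).
Hypotheses (Ue : uniq e) (e_rho : e =i cover rho).
Hypotheses (rho_part : partition rho (cover rho)).

Local Notation I := (starts e rho).
Local Notation S := (singletons rho).
Local Notation rho' := (delete (I :|: S) rho).
Local Notation e' := (filter (mem (cover rho')) e).
Local Notation pr := (next (rev e)).

Let rho_triv : trivIset rho. Proof. by case/and3P: rho_part. Qed.
Let rho'_part : partition rho' (cover rho').
Proof. exact: partition_delete. Qed.
Let Ur : uniq (rev e). Proof. by rewrite rev_uniq. Qed.
Let nextK : cancel (next e) pr.
Proof. by move=> x; rewrite next_rev // prev_next. Qed.
Let prK : cancel pr (next e).
Proof. by move=> x; rewrite next_rev // next_prev. Qed.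
Let pr_cover x : (pr x \in cover rho) = (x \in cover rho).
Proof. by rewrite -!e_rho -!(mem_rev e) mem_next. Qed.
Let next_cover x : (next e x \in cover rho) = (x \in cover rho).
Proof. by rewrite -!e_rho mem_next. Qed.

(** Apart from a one-element support, no initiator is followed by a singleton: each run deleted
    between remaining elements has its [S] part before its [I] part. *)
Lemma start_before_singleton t : t \in I -> next e t \in S -> next e t = t.
Proof.
rewrite inE => /andP[tR' tI] tS; exact/esym/(singleton_same rho_part tS tR' tI).
Qed.

(** If the run after [a] had no element of [S], it would lie in the block of the next remaining
    element, which is the block of [a]; then [a] would be an initiator of [rho] and would have been
    deleted. *)
Lemma next_start_rest a :
  a \in cover rho' -> a \in starts e' rho' -> next e a \in S.
Proof.
move=> aB; have [aR aI aS] := mem_restP _ _ _ aB.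
rewrite inE => /andP[_]; apply: contraTT => cS.
have cR : next e a \in cover rho by rewrite next_cover.
have Lrest := land_rest Ue e_rho rho_part cR cS aB.
have [||k [def_L _ jI]] := @landP _ e I (next e a) Ue; first by rewrite e_rho.
  by exists a; rewrite ?e_rho.
have -> : next e' a = land e I (next e a).
  rewrite def_L -iterSr; apply: next_filter => //.
  - by rewrite e_rho.
  - by rewrite iterSr -def_L.
  by move=> j /jI jI'; rewrite iterSr; apply: contraL jI'; case/mem_restP.
rewrite pblock_delete // !inE negb_and; apply/orP; right.
have Lc := land_pblock e rho_part cR.
apply: contra aI => La; rewrite inE aR -(same_pblock rho_triv La).
by rewrite (same_pblock rho_triv Lc) mem_pblock.
Qed.

(** As [b] is not a singleton of [rho], its block there has another element [y]. The walk from [y]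
    along initiators must end at [b], the only survivor of the block, so its last step starts from
    an initiator. *)
Lemma prev_singleton_rest b :
  b \in cover rho' -> b \in singletons rho' -> pr b \in I.
Proof.
move=> bB /(singletonsP _ rho'_part)[_ b1]; have [bR bI bS] := mem_restP _ _ _ bB.
have [y yb neq_yb] : exists2 y, y \in pblock rho b & y != b.
  apply/exists_inP; apply: contraR bS => /exists_inPn yb.
  apply/(singletonsP _ rho_part); split=> // y /yb; rewrite negbK => /eqP //.
have yR : y \in cover rho by rewrite -mem_pblock (same_pblock rho_triv yb).
have yS : y \notin S.
  apply: contra neq_yb => yS.
  by rewrite (singleton_same rho_part yS bR yb).
have Lrest := land_rest Ue e_rho rho_part yR yS bB.
have Ly := land_pblock e rho_part yR.
have def_b : land e I y = b.
  apply: b1; rewrite pblock_delete // -(same_pblock rho_triv yb).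
  by move: Lrest; rewrite cover_delete !in_setD Ly => /andP[->].
(* A walk of length 0 is excluded by [y != b]. *)
have [||[|k] [def_L _ jI]] := @landP _ e I y Ue; first by rewrite e_rho.
- by exists b; rewrite ?e_rho.
- by move: def_L neq_yb; rewrite def_b => -> /=; rewrite eqxx.
by rewrite -def_b def_L iterS nextK jI.
Qed.

Hypotheses (tau_part : partition tau (cover tau)).
Hypotheses (tau_cover : cover tau = cover rho').
Hypotheses (tauS : singletons tau = starts e' rho').
Hypotheses (tauT : starts (rev e') tau = singletons rho').

Let tau_triv : trivIset tau. Proof. by case/and3P: tau_part. Qed.

(* Elements of I become singletons, and every element of S joins the block of *)
(* its predecessor.                                                           *)
Let F x := if x \in I then [set x] else pblock tau (land (rev e) S x).

(** Taking the fibres of [F] gives a partition of [cover rho] at once, with block membership reduced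
    to an equality of values of [F]. *)
Definition recombined : {set {set 'I_n}} := preim_partition F (cover rho).

Lemma recombined_part : partition recombined (cover rho).
Proof. exact: preim_partitionP. Qed.

Lemma recombined_cover : cover recombined = cover rho.
Proof. by case/and3P: recombined_part => /eqP. Qed.

Lemma pblock_recombined x y :
  x \in cover rho -> y \in cover rho ->
  (y \in pblock recombined x) = (F x == F y).
Proof. exact: pblock_preim. Qed.

Let restF x : x \in cover rho' -> F x = pblock tau x.
Proof. by case/mem_restP=> xR xI xS; rewrite /F (negPf xI) land_id. Qed.

(** The values of [F] outside [I] are subsets of [cover tau], which contains no element of [I]. *)
Let startF x y : x \in I -> F y = F x -> y = x.
Proof.
move=> xI; rewrite {2}/F xI /F; case: ifP => [_ /set1_inj // | yI Fy].
have: x \in cover tau.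
  apply: (subsetP (pblock_sub_cover tau (land (rev e) S y))).
  by rewrite Fy set11.
by rewrite tau_cover => /mem_restP[_]; rewrite xI.
Qed.

Let land_rest' x b :
  b \in cover rho' -> x \in cover rho -> x \notin I ->
  land (rev e) S x \in cover rho'.
Proof.
move=> bB xR xI; have [bR bI bS] := mem_restP _ _ _ bB.
have [||k [_ LS _]] := @landP _ (rev e) S x Ur; first by rewrite mem_rev e_rho.
  by exists b; rewrite ?mem_rev ?e_rho.
suff [LR LI] : land (rev e) S x \in cover rho /\ land (rev e) S x \notin I.
  exact: mem_rest.
apply: (land_ind (Q := fun z => z \in cover rho /\ z \notin I)) => // y yS [yR yI].
rewrite pr_cover; split=> //; apply: contra yI => prI.
have := start_before_singleton prI; rewrite prK => /(_ yS) {1}->.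
exact: prI.
Qed.

Let prevF x : x \in S -> F (pr x) = F x.
Proof.
move=> xS; have xR := subsetP (singletons_sub rho) x xS.
have [xI | xI] := boolP (x \in I).
  have /(singletonsP _ rho_part)[_ x1] := xS.
  have fix_x : next e x = x by apply: x1; move: xI; rewrite inE => /andP[].
  by rewrite -{1}fix_x nextK.
have prI : pr x \notin I.
  apply: contra xI => prI; have := start_before_singleton prI.
  by rewrite prK => /(_ xS) ->.
rewrite /F (negPf xI) (negPf prI).
(* With nothing left to land on, both values of [F] are [set0]. *)
have [rho0 | [b bB]] := set_0Vmem (cover rho').
  by rewrite !pblock_notin // tau_cover rho0 inE.
have [bR bI bS] := mem_restP _ _ _ bB.
rewrite land_step // ?mem_rev ?e_rho //; by exists b; rewrite ?mem_rev ?e_rho.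
Qed.

(** An element of [S] is attached to its predecessor. A remaining element alone in [tau] is a start
    of [rho'], so by [next_start_rest] an element of [S] follows and is attached to it. Hence only
    [I] stays alone; a one-element support agrees with this, its element lying in both [I] and
    [S]. *)
Lemma singletons_recombined : singletons recombined = I.
Proof.
have part' : partition recombined (cover recombined).
  by rewrite recombined_cover recombined_part.
apply/setP=> x; apply/(singletonsP _ part')/idP; rewrite recombined_cover.
  case=> xR x1; apply: contraT => xI; have [xS | xS] := boolP (x \in S).
    have fix_x : pr x = x.
      by apply: x1; rewrite pblock_recombined ?pr_cover // prevF.
    by case/negP: xI; rewrite inE xR -{1}fix_x prK mem_pblock.
  have xB := mem_rest xR xI xS.
  have : x \in singletons tau.
    apply/(singletonsP _ tau_part); rewrite tau_cover; split=> // y yx.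
    have yB : y \in cover rho'.
      by rewrite -tau_cover -mem_pblock (same_pblock tau_triv yx) // .
    apply: x1; have [yR _ _] := mem_restP _ _ _ yB.
    by rewrite pblock_recombined // !restF // (same_pblock tau_triv yx).
  rewrite tauS => /(next_start_rest xB) nS.
  have nR : next e x \in cover rho by rewrite next_cover.
  have fix_x : next e x = x.
    by apply: x1; rewrite pblock_recombined // -(prevF nS) nextK.
  by case/negP: xS; rewrite -fix_x.
move=> xI; have xR : x \in cover rho by move: xI; rewrite inE => /andP[].
split=> // y yx; apply: startF => //.
have yR : y \in cover rho.
  rewrite -recombined_cover -mem_pblock (same_pblock _ yx) //.
  by case/and3P: part'.
by apply/esym/eqP; rewrite -pblock_recombined.
Qed.

(** A remaining element in the block of its predecessor would be a terminator of [tau], hence a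
    singleton of [rho']; by [prev_singleton_rest] its predecessor would be in [I], and so alone. *)
Lemma starts_recombined : starts (rev e) recombined = S.
Proof.
apply/setP=> t; rewrite inE recombined_cover.
have [tS | tS] := boolP (t \in S).
  have tR := subsetP (singletons_sub rho) t tS.
  by rewrite tR pblock_recombined ?pr_cover // prevF ?eqxx.
apply: contraNF tS => /andP[tR]; rewrite pblock_recombined ?pr_cover //.
move/eqP/esym=> Fpr; have [tI | tI] := boolP (t \in I).
  have fix_t := startF tI Fpr.
  apply/(singletonsP _ rho_part); split=> // y yt.
  have yR : y \in cover rho by rewrite -mem_pblock (same_pblock rho_triv yt).
  by apply: next_fixed Ur _ _ fix_t; rewrite mem_rev e_rho.
apply: contraT => tS; have tB := mem_rest tR tI tS.
have prI : pr t \notin I.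
  by apply: contra tI => prI; rewrite (startF prI (esym Fpr)).
have LB := land_rest' tB (etrans (pr_cover t) tR) prI.
have [||k [def_L _ jS]] := @landP _ (rev e) S (pr t) Ur.
- by rewrite mem_rev e_rho pr_cover.
- by exists t; rewrite ?mem_rev ?e_rho.
(* Walking back from [pr t] over [S] ends at the predecessor of [t] among the remaining elements. *)
have next_t : next (rev e') t = land (rev e) S (pr t).
  rewrite -filter_rev def_L -iterSr; apply: next_filter => //.
  - by rewrite mem_rev e_rho.
  - by rewrite iterSr -def_L.
  by move=> j /jS jS'; rewrite iterSr; apply: contraL jS'; case/mem_restP.
suff: t \in singletons rho'.
  by move/(prev_singleton_rest tB) => prI'; rewrite prI' in prI.
rewrite -tauT inE tau_cover tB next_t -eq_pblock ?tau_cover //.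
by rewrite -restF // -Fpr /F (negPf prI) eqxx.
Qed.

Lemma delete_recombined : delete (I :|: S) recombined = tau.
Proof.
have part' : partition recombined (cover recombined).
  by rewrite recombined_cover recombined_part.
have cov' : cover (delete (I :|: S) recombined) = cover rho'.
  by rewrite !cover_delete recombined_cover.
apply: (@eq_partition _ _ _ (cover rho')).
- by rewrite -cov'; apply: partition_delete.
- by rewrite -tau_cover.
move=> x y xB yB; rewrite pblock_delete ?cov' // in_setD.
have [[xR _ _] [yR yI yS]] := (mem_restP _ _ _ xB, mem_restP _ _ _ yB).
rewrite in_setU negb_or yI yS pblock_recombined // !restF //.
by rewrite eq_pblock ?tau_cover.
Qed.

End Recombine.

Lemma imsetD_inj (aT rT : finType) (f : aT -> rT) (A B : {set aT}) :
  injective f -> f @: (A :\: B) = f @: A :\: f @: B.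
Proof.
move=> f_inj; apply/setP=> y.
apply/imsetP/setDP => [[x /setDP[xA xB] ->] | [/imsetP[x xA ->]]].
  by rewrite !mem_imset.
by rewrite mem_imset // => xB; exists x; rewrite ?inE ?xB.
Qed.

(** * The cyclic order on supports and the inverse of [separateST] *)

Lemma enum_subset A D : D \subset A -> enum D = filter (mem D) (enum A).
Proof.
move=> sDA; rewrite /enum_mem -filter_predI; apply: eq_filter => x /=.
by case xD: (x \in D) => //=; rewrite (subsetP sDA).
Qed.

Lemma enum_uniq_cover P : uniq (enum (cover P)) /\ enum (cover P) =i cover P.
Proof. by split; [apply: enum_uniq | apply: mem_enum]. Qed.

Lemma successor_fixed A x : x \in A -> successor A x = x -> #|A| = 1.
Proof.
move=> xA fix_x; apply/eqP/cards1P; exists x; apply/setP=> y; rewrite inE.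
apply/idP/eqP=> [yA | -> //].
by apply: next_fixed (enum_uniq A) _ _ fix_x; rewrite mem_enum.
Qed.

Lemma mem_adjacencies P p :
  (p \in adjacencies P) =
    [&& p.1 \in cover P, p.2 == successor (cover P) p.1 & p.2 \in pblock P p.1].
Proof.
rewrite inE; case p1: (p.1 \in cover P) => //=.
case: eqP => //= def_p2; case: (_ \in pblock _ _) => //=.
case: eqP => //= fix_p; apply/eqP; apply: successor_fixed p1 _.
by rewrite -def_p2.
Qed.

Lemma initiatorsE P : initiators P = starts (enum (cover P)) P.
Proof.
apply/setP=> x; rewrite inE; apply/imsetP/andP.
  by case=> p; rewrite mem_adjacencies => /and3P[p1 /eqP-> xp] ->.
case=> xP nx; exists (x, successor (cover P) x) => //.
by rewrite mem_adjacencies /= xP eqxx.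
Qed.

(** An adjacency is determined by its first element. *)
Lemma card_initiators P : #|initiators P| = #|adjacencies P|.
Proof.
apply: card_in_imset => -[x1 x2] [y1 y2]; rewrite !mem_adjacencies /=.
by case/and3P=> _ /eqP-> _ /and3P[_ /eqP-> _] ->.
Qed.

Lemma terminatorsE P :
  partition P (cover P) -> terminators P = starts (rev (enum (cover P))) P.
Proof.
case/and3P=> _ tP _; have Ue := enum_uniq (cover P).
apply/setP=> x; rewrite inE; apply/imsetP/andP.
  case=> -[y1 y2]; rewrite mem_adjacencies /= => /and3P[yP /eqP def_y2 yy] ->.
  rewrite next_rev // def_y2 prev_next // -def_y2 (same_pblock tP yy).
  by rewrite mem_pblock -(mem_pblock P y2) (same_pblock tP yy).
case=> xP; rewrite next_rev // => nx.
have prP : prev (enum (cover P)) x \in cover P.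
  by rewrite -mem_enum mem_prev mem_enum.
exists (prev (enum (cover P)) x, x) => //.
by rewrite mem_adjacencies /= prP /successor next_prev // eqxx (same_pblock tP nx)
           mem_pblock.
Qed.

Lemma terminators_sub P : partition P (cover P) -> terminators P \subset cover P.
Proof. by move/terminatorsE->; apply/subsetP=> x; rewrite inE => /andP[]. Qed.

Lemma separateST_inj P Q :
  partition P (cover P) -> partition Q (cover Q) ->
  separateST P = separateST Q -> P = Q.
Proof.
move=> Ppart Qpart [eq_rest eqS eqT].
(* The support is not part of the output, but it is the union of the remaining and the deleted
   elements. *)
have cover_sep (R : {set {set 'I_n}}) : partition R (cover R) ->
    cover R = cover (delete (terminators R :|: singletons R) R)
              :|: (terminators R :|: singletons R).
  move=> Rpart; rewrite cover_delete setUC.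
  have sub : terminators R :|: singletons R \subset cover R.
    by rewrite subUset singletons_sub andbT; apply: terminators_sub.
  by rewrite -{1}(setIidPr sub) setID.
have cQ : cover Q = cover P.
  by rewrite [LHS]cover_sep // [RHS]cover_sep // eq_rest eqS eqT.
have [Ue eP] : uniq (rev (enum (cover P))) /\ rev (enum (cover P)) =i cover P.
  by split=> [|x]; rewrite ?rev_uniq ?enum_uniq // mem_rev mem_enum.
have TP := terminatorsE Ppart; have TQ := terminatorsE Qpart.
rewrite cQ in TQ; apply: (separate_inj Ue) => //; first by rewrite -TP -TQ.
by rewrite -TP -TQ.
Qed.

Lemma combineST_separateST P :
  partition P (cover P) -> combineST (separateST P) = P.
Proof.
move=> Ppart; rewrite /combineST; case: pickP => [Q /andP[Qpart /eqP] | /(_ P)].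
  exact: separateST_inj.
by rewrite Ppart eqxx.
Qed.

(* The invariant relating rho_j to tau_j. *)
Definition mirrored rho tau : Prop :=
  [/\ partition tau (cover tau), cover tau = cover rho,
      singletons tau = initiators rho & terminators tau = singletons rho].

(** The inductive step: [recombined] is an explicit preimage under [separateST], so [combineST] does
    not fall back on its default value and, by injectivity, returns it. *)
Lemma combineST_mirrored rho tau (tau' := combineST (tau, (separateIS rho).2)) :
    partition rho (cover rho) -> mirrored (separateIS rho).1 tau ->
  separateST tau' = (tau, (separateIS rho).2) /\ mirrored rho tau'.
Proof.
move=> rho_part [tau_part tau_cover tauS tauT].
have [Ue e_rho] := enum_uniq_cover rho.
have enum_rest : enum (cover (separateIS rho).1) =
    filter (mem (cover (separateIS rho).1)) (enum (cover rho)).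
  by apply: enum_subset; rewrite cover_delete subsetDl.
rewrite initiatorsE enum_rest in tauS.
rewrite terminatorsE // tau_cover enum_rest in tauT.
rewrite /separateIS /= initiatorsE in tau_cover tauS tauT.
set r := recombined (enum (cover rho)) rho tau.
have r_cover : cover r = cover rho by apply: recombined_cover.
have r_part : partition r (cover r) by rewrite r_cover; apply: recombined_part.
have rS : singletons r = initiators rho.
  by rewrite initiatorsE; apply: singletons_recombined.
have rT : terminators r = singletons rho.
  by rewrite terminatorsE // r_cover; apply: starts_recombined.
have sep_r : separateST r = (tau, (separateIS rho).2).
  rewrite /separateST rS rT /= setUC {1}initiatorsE.
  by rewrite delete_recombined.
by rewrite /tau' -sep_r combineST_separateST // sep_r; split.
Qed.

(** * Complementation *)

Lemma sorted_enum A : sorted (fun x y => x < y) (enum A).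
Proof.
rewrite /enum_mem; apply: sorted_filter; first by move=> x y z; apply: ltn_trans.
have := iota_ltn_sorted 0 n; rewrite -val_enum_ord sorted_map.
by rewrite enumT.
Qed.

Lemma enum_rev_ord A : enum (@rev_ord n @: A) = rev (map (@rev_ord n) (enum A)).
Proof.
apply: (@irr_sorted_eq _ (fun x y : 'I_n => x < y)).
- by move=> x y z; apply: ltn_trans.
- by move=> x; apply: ltnn.
- exact: sorted_enum.
- rewrite rev_sorted sorted_map; apply: sub_sorted (sorted_enum A) => x y /= ltxy.
  by apply: ltn_sub2l => //; apply: leq_ltn_trans ltxy (ltn_ord y).
move=> x; rewrite mem_enum mem_rev; apply/imsetP/mapP => -[y yA ->];
  by exists y; rewrite ?mem_enum // -mem_enum.
Qed.

Local Notation r := (@rev_ord n).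

Lemma imset_rev_ordK : involutive (fun A : {set 'I_n} => r @: A).
Proof.
move=> A; rewrite -imset_comp -[RHS]imset_id.
by apply: eq_imset => x /=; rewrite rev_ordK.
Qed.

Lemma complementK : involutive (@complement n).
Proof.
move=> P; rewrite /complement -imset_comp -[RHS]imset_id.
by apply: eq_imset => B /=; rewrite imset_rev_ordK.
Qed.

Lemma mem_complement P (B : {set 'I_n}) : (r @: B \in complement P) = (B \in P).
Proof. exact: (mem_imset _ _ (imset_inj (@rev_ord_inj n))). Qed.

Lemma cover_complement P : cover (complement P) = r @: cover P.
Proof.
apply/setP=> x; apply/bigcupP/imsetP.
  case=> _ /imsetP[B BP ->] /imsetP[y yB ->].
  by exists y => //; apply/bigcupP; exists B.
case=> y /bigcupP[B BP yB] ->; exists (r @: B); rewrite ?mem_complement //.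
exact: imset_f.
Qed.

Lemma partition_complement P A : partition P A -> partition (complement P) (r @: A).
Proof.
case/and3P=> /eqP cP /trivIsetP tP P0; apply/and3P; split.
- by rewrite cover_complement cP.
- apply/trivIsetP=> _ _ /imsetP[B BP ->] /imsetP[C CP ->] neqBC.
  rewrite imset_disjoint; last exact: rev_ord_inj.
  by apply: tP => //; apply: contraNneq neqBC => ->.
by rewrite -(imset0 r) mem_complement.
Qed.

Lemma partition_cover_complement P :
  partition P (cover P) -> partition (complement P) (cover (complement P)).
Proof. by rewrite cover_complement; apply: partition_complement. Qed.

Lemma pblock_complement P x :
  partition P (cover P) -> x \in cover P ->
  pblock (complement P) (r x) = r @: pblock P x.
Proof.
move=> Ppart xP; have /and3P[_ tP _] := partition_cover_complement Ppart.
apply: def_pblock => //; first by rewrite mem_complement pblock_mem.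
by rewrite imset_f ?mem_pblock.
Qed.

Lemma delete_complement D P :
  delete (r @: D) (complement P) = complement (delete D P).
Proof.
have rI := imset_inj (@rev_ord_inj n).
rewrite /delete /complement [in RHS]imsetD_inj // imset_set1 imset0 -!imset_comp.
congr (_ :\: _); apply: eq_imset => B /=; rewrite imsetD_inj //.
exact: rev_ord_inj.
Qed.

(** By [enum_rev_ord], complementing reverses the list of the support, which turns successors into
    predecessors. *)
Lemma initiators_complement P :
  partition P (cover P) -> initiators (complement P) = r @: terminators P.
Proof.
move=> Ppart; rewrite initiatorsE terminatorsE //; apply/setP=> x.
rewrite -[x]rev_ordK (mem_imset _ _ (@rev_ord_inj n)) !inE cover_complement.
rewrite (mem_imset _ _ (@rev_ord_inj n)); case xP: (_ \in cover P) => //=.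
rewrite pblock_complement // enum_rev_ord -map_rev next_map ?rev_uniq ?enum_uniq //.
  by rewrite (mem_imset _ _ (@rev_ord_inj n)).
exact: rev_ord_inj.
Qed.

Lemma singletons_complement P : singletons (complement P) = r @: singletons P.
Proof.
apply/setP=> x; rewrite -[x]rev_ordK (mem_imset _ _ (@rev_ord_inj n)) !inE.
by rewrite -imset_set1 mem_complement.
Qed.

Lemma separateIS_complement P rho S T :
  partition P (cover P) -> separateST P = (rho, (S, T)) ->
  separateIS (complement P) = (complement rho, (r @: T, r @: S)).
Proof.
move=> Ppart [<- <- <-]; rewrite /separateIS initiators_complement //.
by rewrite singletons_complement -imsetU delete_complement.
Qed.

Lemma separateST_complement P rho I S :
  partition P (cover P) -> separateIS P = (rho, (I, S)) ->
  separateST (complement P) = (complement rho, (r @: S, r @: I)).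
Proof.
move=> Ppart [<- <- <-]; rewrite /separateST singletons_complement.
have -> : terminators (complement P) = r @: initiators P.
  have := initiators_complement (partition_cover_complement Ppart).
  by rewrite complementK => ->; rewrite imset_rev_ordK.
by rewrite -imsetU delete_complement.
Qed.

(** * Iteration *)

(** [phi] as a recursion on the partition, with a free number [k] of rounds, so that a partition and
    its conjugate can be compared at the same [k] without relating their depths. *)
Fixpoint rebuild rho k : {set {set 'I_n}} :=
  if k is k'.+1 then
    combineST (rebuild (separateIS rho).1 k', (separateIS rho).2)
  else rho.

Lemma rebuildE rho k :
  rebuild rho k.+1
    = combineST (rebuild (separateIS rho).1 k, (separateIS rho).2).
Proof. by []. Qed.

Lemma residueS P k : residue P k.+1 = residue (separateIS P).1 k.
Proof. exact: iterSr. Qed.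

Lemma foldr_rebuild P i k :
  foldr (fun j tau => combineST (tau, (separateIS (residue P j.-1)).2))
        (residue P (i + k)) (iota i.+1 k)
    = rebuild (residue P i) k.
Proof.
elim: k i => [|k IHk] i; first by rewrite addn0.
by rewrite rebuildE -[(separateIS _).1]/(residue P i.+1) -IHk addSnnS.
Qed.

Lemma phiE P : phi P = rebuild P (depth P).
Proof. exact: (foldr_rebuild P 0 (depth P)). Qed.

Definition final rho := (initiators rho == set0) && (singletons rho == set0).

Lemma separateIS_final rho :
  partition rho (cover rho) -> final rho -> separateIS rho = (rho, (set0, set0)).
Proof.
move=> /and3P[_ _ rho0] /andP[/eqP I0 /eqP S0].
rewrite /separateIS I0 S0 setU0; congr (_, _); rewrite /delete.
have -> : [set B :\: set0 | B in rho] = rho.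
  by rewrite -[RHS]imset_id; apply: eq_imset => B; rewrite setD0.
by apply/setDidPl; rewrite disjoint_sym disjoints1.
Qed.

Lemma partition_separateIS rho :
  partition rho (cover rho) ->
  partition (separateIS rho).1 (cover (separateIS rho).1).
Proof. exact: partition_delete. Qed.

Lemma mirrored_final rho :
  partition rho (cover rho) -> final rho -> mirrored rho rho.
Proof.
move=> rho_part /andP[/eqP I0 /eqP S0]; split; rewrite ?I0 ?S0 //.
apply/eqP; move/eqP: I0; rewrite /initiators /terminators !imset_eq0 //.
Qed.

Lemma rebuild_mirrored rho k :
  partition rho (cover rho) -> final (residue rho k) ->
  mirrored rho (rebuild rho k).
Proof.
elim: k rho => [|k IHk] rho rho_part; first exact: mirrored_final.
rewrite residueS => /(IHk _ (partition_separateIS rho_part)) mir.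
by have [] := combineST_mirrored rho_part mir.
Qed.

(** Separating the conjugate peels off what the last recombination inserted, with [I] and [S]
    swapped and reflected. *)
Lemma rebuildS rho k (tau := rebuild (separateIS rho).1 k) :
    partition rho (cover rho) -> final (residue rho k.+1) ->
  separateIS (complement (rebuild rho k.+1)) =
    (complement tau, (r @: singletons rho, r @: initiators rho)).
Proof.
move=> rho_part fin.
have [part' _ _ _] := rebuild_mirrored rho_part fin.
rewrite residueS in fin; have rest_part := partition_separateIS rho_part.
have [sep _] := combineST_mirrored rho_part (rebuild_mirrored rest_part fin).
exact: separateIS_complement part' sep.
Qed.

Lemma residue_complement_rebuild rho k :
    partition rho (cover rho) -> final (residue rho k) ->
  residue (complement (rebuild rho k)) k = complement (residue rho k).
Proof.
elim: k rho => // k IHk rho rho_part fin.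
have rest_part := partition_separateIS rho_part.
rewrite [LHS]residueS rebuildS // [in RHS]residueS.
by rewrite residueS in fin; apply: IHk.
Qed.

Lemma rebuild_complement_rebuild rho k :
    partition rho (cover rho) -> final (residue rho k) ->
  rebuild (complement (rebuild rho k)) k = complement rho.
Proof.
elim: k rho => // k IHk rho rho_part fin.
have rest_part := partition_separateIS rho_part.
have fin' : final (residue (separateIS rho).1 k) by rewrite -residueS.
rewrite rebuildE rebuildS // IHk //.
rewrite -(separateST_complement rho_part (erefl (separateIS rho))).
exact/combineST_separateST/partition_cover_complement.
Qed.

Lemma partition_residue rho k :
  partition rho (cover rho) -> partition (residue rho k) (cover (residue rho k)).
Proof. by move=> rho_part; elim: k => //= k; apply: partition_separateIS. Qed.

Lemma final_residue_step rho k :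
    partition rho (cover rho) -> final (residue rho k) ->
  residue rho k.+1 = residue rho k.
Proof.
move=> rho_part fin; rewrite /residue iterS -/(residue rho k).
by rewrite separateIS_final //; apply: partition_residue.
Qed.

Lemma rebuild_step rho k :
    partition rho (cover rho) -> final (residue rho k) ->
  rebuild rho k.+1 = rebuild rho k.
Proof.
elim: k rho => [|k IHk] rho rho_part fin.
  have [_ _ _ T0] := mirrored_final rho_part fin.
  have sep := separateIS_final rho_part fin.
  (* On a final partition [separateIS] and [separateST] have the same output, so the extra round is
     undone. *)
  rewrite rebuildE sep -[RHS]combineST_separateST //; congr combineST.
  move: sep; rewrite /separateIS /separateST T0; case/andP: fin => /eqP-> /eqP->.
  by rewrite setU0 => -[->].
rewrite residueS in fin.
by rewrite [RHS]rebuildE -IHk //; apply: partition_separateIS.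
Qed.

Lemma rebuild_stable rho k m :
    partition rho (cover rho) -> final (residue rho k) -> k <= m ->
  rebuild rho m = rebuild rho k.
Proof.
move=> rho_part fin /subnK<-; elim: (m - k) => // d IHd.
suff fin_d : final (residue rho (d + k)) by rewrite addSn rebuild_step.
by elim: d {IHd} => // d IHd; rewrite addSn final_residue_step.
Qed.

(** Rounds after a final stage are idle, so any final stage may replace the minimal one; here [k]
    may even be 0, whereas [depth] is positive. *)
Lemma phi_rebuild rho k :
  partition rho (cover rho) -> final (residue rho k) -> phi rho = rebuild rho k.
Proof.
move=> rho_part fin; rewrite phiE /depth; case: ex_minnP => m /and3P[_ I0 S0] _.
have fin_m : final (residue rho m) by rewrite /final I0 S0.
case/orP: (leq_total k m) => [/rebuild_stable-> // | lemk].
by rewrite [RHS](rebuild_stable _ _ lemk).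
Qed.

Lemma final_depth rho : final (residue rho (depth rho)).
Proof. by rewrite /depth; case: ex_minnP => m /and3P[_ I0 S0] _; apply/andP. Qed.

Lemma final_complement P :
  partition P (cover P) -> final P -> final (complement P).
Proof.
move=> Ppart fin; have [_ _ _ T0] := mirrored_final Ppart fin.
case/andP: fin => _ /eqP S0; rewrite /final initiators_complement // T0.
by rewrite singletons_complement S0 imset0 eqxx.
Qed.

Lemma mirrored_phi P : partition P (cover P) -> mirrored P (phi P).
Proof.
by move=> Ppart; rewrite phiE; apply: rebuild_mirrored => //; apply: final_depth.
Qed.

Lemma conjugateK P : partition P (cover P) -> conjugate (conjugate P) = P.
Proof.
move=> Ppart; have fin := final_depth P; rewrite /conjugate [phi P]phiE.
(* The stage [depth P] is final for the conjugate as well, its residue there being the complement of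
   that of [P]. *)
rewrite (@phi_rebuild _ (depth P)).
- by rewrite rebuild_complement_rebuild // complementK.
- by apply: partition_cover_complement; case: (rebuild_mirrored Ppart fin).
rewrite residue_complement_rebuild //; apply: final_complement => //.
exact: partition_residue.
Qed.

End Separation.

Theorem theorem2 (n : nat) (n_gt0 : 0 < n) :
  (forall pi : {set {set 'I_n}}, partition pi [set: 'I_n] ->
     partition (conjugate pi) [set: 'I_n] /\ conjugate (conjugate pi) = pi) /\
  (forall pi : {set {set 'I_n}}, partition pi [set: 'I_n] ->
     #|singletons (conjugate pi)| = #|adjacencies pi| /\
     #|adjacencies (conjugate pi)| = #|singletons pi|).
Proof.
split=> pi pi_part; have /and3P[/eqP cover_pi _ _] := pi_part.
  have pi_part' : partition pi (cover pi) by rewrite cover_pi.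
  have [part_phi cover_phi _ _] := mirrored_phi pi_part'.
  split; last exact: conjugateK.
  have := partition_complement part_phi; rewrite cover_phi cover_pi.
  suff -> : @rev_ord n @: [set: 'I_n] = [set: 'I_n] by [].
  by apply/setP=> x; rewrite -[x]rev_ordK mem_imset ?inE //; apply: rev_ord_inj.
rewrite -cover_pi in pi_part.
have [part_phi _ phiS phiT] := mirrored_phi pi_part.
rewrite /conjugate singletons_complement.
rewrite -[#|adjacencies (complement _)|]card_initiators initiators_complement //.
by rewrite !(card_imset _ (@rev_ord_inj n)) phiS phiT card_initiators.
Qed.
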